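(* Let $X$ be a locally compact Hausdorff space, and let $k=k(x,y)$ be a real-valued continuous kernel on $X\times X$, with associated real reproducing kernel Hilbert space $\mathcal{H}_k$. Suppose that $\mathcal{H}_k$ separates any two distinct points in $X$, that is, for any $x\ne y$ in $X$ there is $\psi\in\mathcal{H}_k$ with $\psi(x)\neq\psi(y)$. Then, for any compact subset $K$ of $X$, any $\varepsilon>0$ and any function $f$ in $C(K)$, there exist $c_1,\ldots,c_N$ in $\mathbb{R}$ and $a_1,\ldots,a_N$ in $X$ such that \[ \left\| f-\sum_{j=1}^N c_j\exp k(\cdot,a_j)\right\|_{\infty,K}<\varepsilon . \]
   Context: A real-valued kernel on $X\times X$ is a function $k:X\times X\to\mathbb{R}$ with $k(y,x)=k(x,y)$ and $\sum_{i,j=1}^n c_ic_jk(x_i,x_j)\ge 0$ for any $n\ge1$, any $x_1,\ldots,x_n\in X$ and any $(c_1,\ldots,c_n)\in\mathbb{R}^n$. $\mathcal{H}_k$ denotes the (real) reproducing kernel Hilbert space of functions on $X$ generated by $k$, i.e. the unique Hilbert space of real-valued functions on $X$ that contains $k_x=k(\cdot,x)$ and satisfies $f(x)=\langle f,k_x\rangle_{\mathcal{H}_k}$ for all $x\in X$, $f\in\mathcal{H}_k$. $C(K)$ is the Banach algebra of all real-valued continuous functions on $K$, and $\|f\|_{\infty,K}=\sup_{x\in K}|f(x)|$. *)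

(* Defs.v *)
From HB Require Import structures.
From mathcomp Require Import all_boot all_order all_algebra.
From mathcomp Require Import all_classical all_reals all_analysis.

Set Implicit Arguments.
Unset Strict Implicit.
Unset Printing Implicit Defensive.

Import Order.TTheory GRing.Theory Num.Theory numFieldNormedType.Exports.

Local Open Scope classical_set_scope.
Local Open Scope ring_scope.

Definition is_kernel (R : realType) (X : Type) (k : X -> X -> R) : Prop :=
  (forall x y, k y x = k x y) /\
  (forall (n : nat) (x : 'I_n -> X) (c : 'I_n -> R), (0 < n)%N ->
    0 <= \sum_(i < n) \sum_(j < n) c i * c j * k (x i) (x j)).

Definition ip_norm (R : realType) (X : Type)
    (ip : (X -> R) -> (X -> R) -> R) (f : X -> R) : R :=
  Num.sqrt (ip f f).

(* [H] is the carrier of a real Hilbert space of functions on [X].  The inner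
   product [ip] is a total function whose values matter only on [H]. *)
Record is_hilbert_function_space (R : realType) (X : Type)
    (H : set (X -> R)) (ip : (X -> R) -> (X -> R) -> R) : Prop := {
  hfs_zero : H 0 ;
  hfs_linear : forall (a : R) (f g : X -> R), H f -> H g -> H (a *: f + g) ;
  hfs_ip_sym : forall f g, H f -> H g -> ip g f = ip f g ;
  hfs_ip_linear : forall (a : R) (f g h : X -> R), H f -> H g -> H h ->
    ip (a *: f + g) h = a * ip f h + ip g h ;
  hfs_ip_ge0 : forall f, H f -> 0 <= ip f f ;
  hfs_ip_eq0 : forall f, H f -> ip f f = 0 -> f = 0 ;
  hfs_complete : forall u : nat -> X -> R, (forall n, H (u n)) ->
    (forall e : R, 0 < e -> exists N : nat, forall m n : nat,
      (N <= m)%N -> (N <= n)%N -> ip_norm ip (u m - u n) < e) ->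
    exists2 f, H f & ip_norm ip (u n - f) @[n --> \oo] --> (0 : R)
}.

(* [(H, ip)] is the reproducing kernel Hilbert space of [k]; these conditions
   determine [H], and [ip] on [H], uniquely (Moore-Aronszajn). *)
Record is_rkhs (R : realType) (X : Type) (k : X -> X -> R)
    (H : set (X -> R)) (ip : (X -> R) -> (X -> R) -> R) : Prop := {
  rkhs_hilbert : is_hilbert_function_space H ip ;
  rkhs_kernel : forall x, H (k ^~ x) ;
  rkhs_reproducing : forall (f : X -> R) (x : X), H f -> f x = ip f (k ^~ x)
}.

Definition separates_points (R : realType) (X : Type) (H : set (X -> R)) :
    Prop :=
  forall x y : X, x <> y -> exists2 psi, H psi & psi x <> psi y.

(* Equals [0] when [K] is empty, since [sup set0 = 0]. *)
Definition sup_norm (R : realType) (X : Type) (K : set X) (g : X -> R) : R :=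
  sup [set `|g x| | x in K].

(* Main.v *)
(* For psi in H, the function exp psi is a uniform limit on K of elements of
   the span of the exp k(., a).  Indeed exp <u, v> is a positive kernel on H by
   the Schur product theorem, exp psi(x) = exp <psi, k_x>, and the minimizing
   sequence for the distance from the feature of psi to the span of the features
   of the k_a converges at each k_x, uniformly where k(x, x) is bounded.  The
   functions exp psi with psi in H continuous are closed under products, and
   they separate points: if k(a, x) = k(a, y) for all a then every psi in H
   takes the same value at x and y.  The Stone-Weierstrass theorem concludes. *)

Require Import Defs.
From HB Require Import structures.
From mathcomp Require Import all_boot all_order all_algebra.
From mathcomp Require Import all_classical all_reals all_analysis.
From mathcomp Require Import ring lra.

Import Order.TTheory GRing.Theory Num.Theory numFieldNormedType.Exports.

Set Implicit Arguments.
Unset Strict Implicit.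
Unset Printing Implicit Defensive.

Local Open Scope classical_set_scope.
Local Open Scope ring_scope.

(** * Positive kernels and their exponentials *)

Definition psd_matrix (R : realType) (n : nat) (A : 'I_n -> 'I_n -> R) : Prop :=
  (forall i j, A j i = A i j) /\
  (forall c : 'I_n -> R, 0 <= \sum_(i < n) \sum_(j < n) c i * c j * A i j).

Lemma sum_delta (R : realType) (n : nat) (i : 'I_n) (F : 'I_n -> R) :
  \sum_(j < n) (j == i)%:R * F j = F i.
Proof.
rewrite (bigD1 i) //= eqxx mul1r big1 ?addr0 // => j /negbTE ->.
by rewrite mul0r.
Qed.

(** On the line through [c] along the [i]-th basis vector, the quadratic form is a polynomial of
    degree two in [t]; its sign yields Cauchy-Schwarz. *)
Lemma quadratic_shift (R : realType) (n : nat) (A : 'I_n -> 'I_n -> R)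
    (c : 'I_n -> R) (i : 'I_n) (t : R) : (forall i j, A j i = A i j) ->
  \sum_(j < n) \sum_(l < n)
     (c j + (j == i)%:R * t) * (c l + (l == i)%:R * t) * A j l =
  \sum_(j < n) \sum_(l < n) c j * c l * A j l
  + 2 * t * \sum_(j < n) c j * A i j + t ^+ 2 * A i i.
Proof.
move=> symA.
under eq_bigr => j _.
  have -> : \sum_(l < n)
       (c j + (j == i)%:R * t) * (c l + (l == i)%:R * t) * A j l =
     \sum_(l < n) c j * c l * A j l + t * (c j * A i j)
     + (j == i)%:R * (t * \sum_(l < n) c l * A j l + t ^+ 2 * A j i).
    rewrite -[X in t * (_ * X)]symA.
    rewrite -[A j i](sum_delta i (A j)) !mulrDr !mulr_sumr.
    rewrite -!big_split /=; apply: eq_bigr => l _; ring.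
  over.
by rewrite !big_split /= sum_delta -mulr_sumr; ring.
Qed.

Lemma psd_diag_ge0 (R : realType) (n : nat) (A : 'I_n -> 'I_n -> R) i :
  psd_matrix A -> 0 <= A i i.
Proof.
move=> [symA /(_ (fun j => 0 + (j == i)%:R * 1))].
rewrite (quadratic_shift (fun=> 0) i 1 symA).
rewrite !big1 => [| j _ | j _]; last 2 first.
- by rewrite mul0r.
- by rewrite big1 // => l _; rewrite !mul0r.
by rewrite mulr0 !add0r expr1n mul1r.
Qed.

Lemma psd_cauchy_schwarz (R : realType) (n : nat) (A : 'I_n -> 'I_n -> R)
    (i : 'I_n) (c : 'I_n -> R) : psd_matrix A ->
  (\sum_(j < n) c j * A i j) ^+ 2 <=
  A i i * \sum_(j < n) \sum_(l < n) c j * c l * A j l.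
Proof.
move=> psdA; have Aii := psd_diag_ge0 i psdA; case: psdA => symA posA.
set L := \sum_(j < n) c j * A i j.
set q := \sum_(j < n) \sum_(l < n) c j * c l * A j l.
have shift t : 0 <= q + 2 * t * L + t ^+ 2 * A i i.
  by rewrite /q /L -(quadratic_shift c i t symA).
have [A0|A0] := eqVneq (A i i) 0.
  have [->|L0] := eqVneq L 0; first by rewrite A0 mul0r expr0n.
  (* With [A i i = 0] the form is affine in [t]; here it equals [- q - 2], which is negative because
     [shift 0] gives [0 <= q]. *)
  have := shift (- (q + 1) / L); rewrite A0 mulr0 addr0.
  have -> : 2 * (- (q + 1) / L) * L = - 2 * (q + 1) by field.
  by have := shift 0; rewrite A0; lra.
have Ap : 0 < A i i by rewrite lt_neqAle eq_sym A0.
(* The minimizer of the quadratic in [t]. *)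
have := shift (- L / A i i).
have -> : q + 2 * (- L / A i i) * L + (- L / A i i) ^+ 2 * A i i =
          (A i i * q - L ^+ 2) / A i i by field.
by rewrite pmulr_lge0 ?invr_gt0// subr_ge0.
Qed.

(** The subtracted part of the form is a square divided by [A i i], so positivity is Cauchy-Schwarz
    against the [i]-th basis vector. *)
Lemma psd_schur_complement (R : realType) (n : nat) (A : 'I_n -> 'I_n -> R)
    (i : 'I_n) : psd_matrix A -> A i i != 0 ->
  psd_matrix (fun j l => A j l - A i j * A i l / A i i).
Proof.
move=> psdA Aii0; split=> [j l|c].
  by rewrite psdA.1 [A i l * _]mulrC.
have Aii := psd_diag_ge0 i psdA.
have -> : \sum_(j < n) \sum_(l < n)
            c j * c l * (A j l - A i j * A i l / A i i) =
   \sum_(j < n) \sum_(l < n) c j * c l * A j l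
   - (\sum_(j < n) c j * A i j) ^+ 2 / A i i.
  rewrite expr2 mulr_suml mulr_suml -sumrB; apply: eq_bigr => j _.
  rewrite mulr_sumr mulr_suml -sumrB; apply: eq_bigr => l _; ring.
rewrite subr_ge0 ler_pdivrMr; last by rewrite lt_neqAle eq_sym Aii0.
by rewrite mulrC psd_cauchy_schwarz.
Qed.

(* Pivoting on a nonzero diagonal entry writes [A] as a rank-one matrix plus a
   positive matrix with fewer nonzero diagonal entries. *)
Lemma schur_product (R : realType) (n : nat) (A B : 'I_n -> 'I_n -> R) :
  psd_matrix A -> psd_matrix B ->
  psd_matrix (fun i j => A i j * B i j).
Proof.
move=> + psdB; have [m] := ubnP #|[pred i | A i i != 0]|.
elim: m A => // m IH A cardA psdA.
split=> [i j|c]; first by rewrite psdA.1 psdB.1.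
have [/existsP[i Ai0]|/existsPn A0] := boolP [exists i, A i i != 0].
  pose A' j l := A j l - A i j * A i l / A i i.
  have psdA' : psd_matrix A' by exact: psd_schur_complement.
  have Aii := psd_diag_ge0 i psdA.
  have subA' : [pred j | A' j j != 0] \proper [pred j | A j j != 0].
    apply/properP; split; last first.
      by exists i; rewrite !inE// negbK /A' mulfK// subrr.
    apply/fintype.subsetP => j; rewrite !inE; apply: contraNN => /eqP Aj0.
    apply/eqP/le_anti; rewrite psd_diag_ge0// andbT /A' Aj0 sub0r oppr_le0.
    by rewrite mulr_ge0 ?invr_ge0// -expr2 sqr_ge0.
  have [|_ /(_ c) A'B] := IH A' _ psdA'.
    exact: leq_trans (proper_card subA') _.
  (* The rank-one part times [B] has as its form that of [B] at this rescaled vector, divided by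
     [A i i]. *)
  have := psdB.2 (fun j => c j * A i j).
  have -> : \sum_(j < n) \sum_(l < n) c j * c l * (A j l * B j l) =
     \sum_(j < n) \sum_(l < n) c j * c l * (A' j l * B j l) +
     (\sum_(j < n) \sum_(l < n) c j * A i j * (c l * A i l) * B j l) / A i i.
    rewrite mulr_suml -big_split; apply: eq_bigr => j _ /=.
    rewrite mulr_suml -big_split; apply: eq_bigr => l _ /=.
    by rewrite /A'; field.
  by move=> ?; rewrite addr_ge0// divr_ge0.
(* By Cauchy-Schwarz, a positive matrix with zero diagonal vanishes. *)
have {}A0 j l : A j l = 0.
  have /eqP Aj0 := negPn (A0 j).
  have := psd_cauchy_schwarz j (fun m => (m == l)%:R) psdA.
  rewrite sum_delta Aj0 mul0r => Ajl; apply/eqP.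
  by rewrite -sqrf_eq0 eq_le Ajl sqr_ge0.
by rewrite !big1 // => j _; rewrite big1 // => l _; rewrite A0 mul0r mulr0.
Qed.

(** Entrywise powers are positive by the Schur product, hence so are the partial sums of the
    exponential series, and positivity passes to the limit. *)
Lemma psd_exp (R : realType) (n : nat) (A : 'I_n -> 'I_n -> R) :
  psd_matrix A -> psd_matrix (fun i j => expR (A i j)).
Proof.
move=> psdA.
have psdX m : psd_matrix (fun i j => A i j ^+ m).
  elim: m => [|m IH]; last first.
    have [sAm posAm] := schur_product psdA IH.
    split=> [i j|c]; first by rewrite psdA.1.
    by under eq_bigr do under eq_bigr do rewrite exprS; exact: posAm.
  split=> [//|c]; rewrite (_ : \sum_(i < n) _ = (\sum_(i < n) c i) ^+ 2).
    exact: sqr_ge0.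
  rewrite expr2 mulr_suml; apply: eq_bigr => i _.
  by rewrite mulr_sumr; apply: eq_bigr => j _; rewrite expr0 mulr1.
split=> [i j|c]; first by rewrite psdA.1.
have cvgS : (\sum_(i < n) \sum_(j < n) c i * c j * series (exp_coeff (A i j)) m)
    @[m --> \oo] --> \sum_(i < n) \sum_(j < n) c i * c j * expR (A i j).
  apply: (@cvg_big R) => [|i _]; first exact: add_continuous.
  apply: (@cvg_big R) => [|j _]; first exact: add_continuous.
  apply: cvgM; first exact: cvg_cst.
  exact: is_cvg_series_exp_coeff.
rewrite -(cvg_lim _ cvgS)//.
apply: limr_ge; first by apply/cvg_ex; eexists; exact: cvgS.
apply: nearW => m.
rewrite (_ : \sum_(i < n) _ =
  \sum_(0 <= l < m)
    (\sum_(i < n) \sum_(j < n) c i * c j * A i j ^+ l) / l`!%:R).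
  by apply: sumr_ge0 => l _; rewrite divr_ge0 ?ler0n//; exact: (psdX l).2.
under [RHS]eq_bigr do rewrite mulr_suml.
rewrite [RHS]exchange_big; apply: eq_bigr => i _ /=.
under [RHS]eq_bigr do rewrite mulr_suml.
rewrite [RHS]exchange_big; apply: eq_bigr => j _ /=.
rewrite /series /= mulr_sumr; apply: eq_bigr => l _.
by rewrite /exp_coeff /= mulrA.
Qed.

(** * Approximation in the Hilbert space of a kernel *)

Lemma kernel_exp (R : realType) (X : Type) (k : X -> X -> R) :
  is_kernel k -> is_kernel (fun x y => expR (k x y)).
Proof.
move=> [symk posk]; split=> [x y|n x c n_gt0]; first by rewrite symk.
have psdk : psd_matrix (fun i j => k (x i) (x j)).
  by split=> [i j|d]; [exact: symk|exact: posk].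
exact: (psd_exp psdk).2.
Qed.

Lemma kernel_seq_ge0 (R : realType) (X : Type) (k : X -> X -> R)
    (s : seq (R * X)) : is_kernel k ->
  0 <= \sum_(p <- s) \sum_(q <- s) p.1 * q.1 * k p.2 q.2.
Proof.
move=> [_ posk]; have [/size0nil ->|s0] := eqVneq (size s) 0%N.
  by rewrite big_nil.
rewrite (big_tnth _ _ s).
under eq_bigr do rewrite (big_tnth _ _ s).
by apply: (posk _ (fun i => (tnth (in_tuple s) i).2)
  (fun i => (tnth (in_tuple s) i).1)); rewrite lt0n.
Qed.

Lemma kernel_seq_cons (R : realType) (X : Type) (k : X -> X -> R)
    (p0 : R * X) (s : seq (R * X)) : (forall x y, k y x = k x y) ->
  \sum_(p <- p0 :: s) \sum_(q <- p0 :: s) p.1 * q.1 * k p.2 q.2 =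
  p0.1 ^+ 2 * k p0.2 p0.2 + 2 * p0.1 * \sum_(q <- s) q.1 * k q.2 p0.2 +
  \sum_(p <- s) \sum_(q <- s) p.1 * q.1 * k p.2 q.2.
Proof.
move=> symk; rewrite !big_cons.
under [\sum_(j <- s) \sum_(q <- _ :: s) _]eq_bigr do
  rewrite big_cons mulrAC mulrC.
rewrite big_split /= -mulr_sumr.
have -> : \sum_(q <- s) p0.1 * q.1 * k p0.2 q.2 =
          p0.1 * \sum_(q <- s) q.1 * k q.2 p0.2.
  by rewrite mulr_sumr; apply: eq_bigr => q _; rewrite mulrA symk.
by ring.
Qed.

(* The residual of an almost best approximation [s] of the feature of [u] by
   features of points [phi x], in the Hilbert space of [k], is almost
   orthogonal to each of these features: otherwise adding a multiple of one of
   them would decrease the squared distance below its infimum. *)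
Lemma kernel_span_approx (R : realType) (X Y : Type) (k : Y -> Y -> R)
    (phi : X -> Y) (u : Y) (M e : R) : is_kernel k -> 0 < M -> 0 < e ->
  exists w : seq (R * X), forall x, k (phi x) (phi x) <= M ->
    `|k u (phi x) - \sum_(p <- w) p.1 * k (phi p.2) (phi x)| < e.
Proof.
move=> kk M0 e0.
(* [feat w] stands for the feature of [u] plus the combination [w], and [Q] for the squared norm;
   hence the signs are flipped in the final witness. *)
pose feat (w : seq (R * X)) := [seq (p.1, phi p.2) | p <- w] ++ [:: (1, u)].
pose Q s := \sum_(p <- s) \sum_(q <- s) p.1 * q.1 * k p.2 q.2.
pose D := [set Q (feat w) | w in setT].
have lbD : has_lbound D.
  by exists 0 => _ [w _ <-]; exact: kernel_seq_ge0.
have infD : has_inf D by split=> //; exists (Q (feat [::])), [::].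
have [_ [w _ <-] Qw] := inf_adherent (divr_gt0 (exprn_gt0 2 e0) M0) infD.
exists [seq (- p.1, p.2) | p <- w] => x kxM.
set r := _ - _; have rE : r = \sum_(q <- feat w) q.1 * k q.2 (phi x).
  rewrite /r !big_map big_cat big_seq1 big_map /= mul1r addrC -sumrN.
  by congr (_ + _); apply: eq_bigr => p _; rewrite mulNr opprK.
(* Since [k (phi x) (phi x) <= M], a step of [- r / M] lowers the squared norm by at least
   [r ^+ 2 / M]; this explains the tolerance [e ^+ 2 / M] above the infimum. *)
have /= : inf D <= Q (feat ((- r / M, x) :: w)).
  by apply: ge_inf => //; exists ((- r / M, x) :: w).
rewrite {1}/Q /feat /= kernel_seq_cons; last exact: kk.1.
rewrite /= -/(feat w) -rE -/(Q (feat w)) => infr.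
have rM : (- r / M) ^+ 2 * k (phi x) (phi x) <= r ^+ 2 / M.
  rewrite (_ : r ^+ 2 / M = (- r / M) ^+ 2 * M); last by field; rewrite gt_eqF.
  by rewrite ler_wpM2l ?sqr_ge0.
have : r ^+ 2 / M < e ^+ 2 / M.
  have rr : 2 * (- r / M) * r = - 2 * (r ^+ 2 / M) by field; rewrite gt_eqF.
  move: infr; rewrite rr; lra.
rewrite ltr_pM2r ?invr_gt0// -[r ^+ 2]real_normK ?num_real//.
by rewrite ltr_pXn2r ?nnegrE ?normr_ge0 ?(ltW e0).
Qed.

Lemma hfs_sum (R : realType) (X : Type) (H : set (X -> R)) ip (I : Type)
    (r : seq I) (c : I -> R) (h : I -> X -> R) :
  is_hilbert_function_space H ip -> (forall i, H (h i)) ->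
  H (\sum_(i <- r) c i *: h i) /\
  (forall g, H g ->
    ip (\sum_(i <- r) c i *: h i) g = \sum_(i <- r) c i * ip (h i) g).
Proof.
move=> HH Hh; elim: r => [|i r [Hr ipr]].
  rewrite big_nil; split=> [|g Hg]; first exact: hfs_zero HH.
  have H0 := hfs_zero HH; rewrite big_nil.
  have := hfs_ip_linear HH 1 H0 H0 Hg.
  by rewrite scaler0 addr0; lra.
rewrite big_cons; split=> [|g Hg]; first exact: (hfs_linear HH).
by rewrite (hfs_ip_linear HH)// ipr// big_cons.
Qed.

(** The Gram form is the squared norm of the combination. The subtype is used because [ip] is
    constrained only on [H]. *)
Lemma hfs_ip_kernel (R : realType) (X : Type) (H : set (X -> R)) ip :
  is_hilbert_function_space H ip ->
  is_kernel (fun f g : {h | H h} => ip (sval f) (sval g)).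
Proof.
move=> HH; split=> [f g|n h c _].
  exact: (hfs_ip_sym HH (svalP f) (svalP g)).
have [Hs ips] := hfs_sum (index_enum 'I_n) c HH (fun i => svalP (h i)).
suff -> : \sum_(i < n) \sum_(j < n) c i * c j * ip (sval (h i)) (sval (h j)) =
  ip (\sum_(i < n) c i *: sval (h i)) (\sum_(i < n) c i *: sval (h i)).
  exact: hfs_ip_ge0 HH _ Hs.
rewrite ips//; apply: eq_bigr => i _.
rewrite (hfs_ip_sym HH Hs (svalP (h i))) ips; last exact: svalP.
rewrite mulr_sumr; apply: eq_bigr => j _.
by rewrite (hfs_ip_sym HH (svalP (h i)) (svalP (h j))) mulrA.
Qed.

Lemma rkhs_exp_approx (R : realType) (X : Type) (k : X -> X -> R)
    (H : set (X -> R)) ip (psi : X -> R) (M e : R) :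
  is_rkhs k H ip -> H psi -> 0 < e ->
  exists w : seq (R * X), forall x, k x x <= M ->
    `|expR (psi x) - \sum_(p <- w) p.1 * expR (k x p.2)| < e.
Proof.
move=> Hk Hpsi e0; have HH := rkhs_hilbert Hk.
pose phi x : {h | H h} := exist _ (k ^~ x) (rkhs_kernel Hk x).
(* On the diagonal the exponential kernel is [expR (k x x)], so its bound is [expR M], positive for
   any real [M]. *)
have [w wP] := kernel_span_approx phi (exist _ psi Hpsi)
  (kernel_exp (hfs_ip_kernel HH)) (expR_gt0 M) e0.
exists w => x kM; have := wP x; rewrite /=.
rewrite -!(rkhs_reproducing Hk)//; try exact: (rkhs_kernel Hk).
rewrite ler_expR => /(_ kM); congr (`| _ - _ | < _).
apply: eq_bigr => p _; rewrite -(rkhs_reproducing Hk)//.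
exact: (rkhs_kernel Hk).
Qed.

(** * The Stone-Weierstrass theorem *)

(** If [P K] failed, the sets whose complement in [K] satisfies [P] would form a proper filter. It
    would cluster at some [x] in [K], yet contain the complement of a neighbourhood of [x]. *)
Lemma compact_ind (X : topologicalType) (K : set X) (P : set X -> Prop) :
  compact K -> P set0 -> (forall A B, B `<=` A -> P A -> P B) ->
  (forall A B, P A -> P B -> P (A `|` B)) ->
  (forall x, K x -> exists2 U, nbhs x U & P (K `&` U)) -> P K.
Proof.
move=> cK P0 Psub PU Ploc; apply: contrapT => nPK.
pose F : set_system X := [set A | P (K `\` A)].
have FF : ProperFilter F.
  apply: Build_ProperFilter_ex => [A FA|].
    apply/set0P/eqP => A0; apply: nPK; move: FA.
    by rewrite A0 /F /= setD0.
  split=> [|A B FA FB|A B AB].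
  - by rewrite /F /= setDT.
  - by rewrite -[F _]/(P (K `\` (A `&` B))) setDIr; exact: PU.
  - by apply: Psub => x [Kx nBx]; split=> // /AB.
have [|x [Kx clx]] := cK F FF; first by rewrite /F /= setDv.
have [U Ux PKU] := Ploc x Kx.
have [z [/= nUz Uz]] : (~` U) `&` U !=set0.
  by apply: clx => //; rewrite /F /= setDE setCK.
exact: nUz.
Qed.

Definition uniform_closure (R : realType) (X : Type) (K : set X)
    (A : set (X -> R)) : set (X -> R) :=
  [set f | forall e, 0 < e ->
    exists2 g, A g & forall x, K x -> `|f x - g x| < e].

Definition linear_closed_set (R : realType) (X : Type) (A : set (X -> R)) :=
  A 0 /\ forall (a : R) (f g : X -> R), A f -> A g -> A (a *: f + g).

Lemma fct_linE (R : realType) (X : Type) (a : R) (f g : X -> R) x :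
  (a *: f + g) x = a * f x + g x.
Proof. by []. Qed.

Lemma uniform_closure_subset (R : realType) (X : Type) (K : set X)
  (A : set (X -> R)) : A `<=` uniform_closure K A.
Proof. by move=> f Af e e0; exists f => // x _; rewrite subrr normr0. Qed.

Lemma uniform_closure_idem (R : realType) (X : Type) (K : set X)
    (A : set (X -> R)) :
  uniform_closure K (uniform_closure K A) `<=` uniform_closure K A.
Proof.
move=> f clf e e0; have e2 : 0 < e / 2 by rewrite divr_gt0.
have [g clg fg] := clf _ e2; have [h Ah gh] := clg _ e2.
exists h => // x Kx; rewrite (splitr e).
by rewrite (le_lt_trans (ler_distD (g x) _ _))// ltrD ?fg ?gh.
Qed.

Lemma uniform_closure_mono (R : realType) (X : Type) (K : set X)
    (A B : set (X -> R)) :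
  A `<=` B -> uniform_closure K A `<=` uniform_closure K B.
Proof. by move=> AB f clf e /clf[g /AB Bg fg]; exists g. Qed.

Lemma uniform_closure_linear (R : realType) (X : Type) (K : set X)
    (A : set (X -> R)) :
  linear_closed_set A -> linear_closed_set (uniform_closure K A).
Proof.
move=> [A0 Alin]; split; first exact: uniform_closure_subset.
move=> a f g clf clg e e0.
(* Adding 1 keeps the divisor positive when [a = 0]. *)
have a1 : 0 < `|a| + 1 by rewrite ltr_wpDl.
have e2 : 0 < e / 2 by rewrite divr_gt0.
have [f' Af' ff'] := clf _ (divr_gt0 e2 a1).
have [g' Ag' gg'] := clg _ e2.
exists (a *: f' + g'); first exact: Alin.
move=> x Kx; rewrite (_ : _ - _ = a * (f x - f' x) + (g x - g' x)); last first.
  by rewrite !fct_linE; ring.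
rewrite (splitr e) (le_lt_trans (ler_normD _ _))// ler_ltD ?gg'// normrM.
have := ltW (ff' _ Kx); rewrite ler_pdivlMr// => /(le_trans _); apply.
by rewrite mulrC ler_wpM2l// lerDl.
Qed.

(* A polynomial in [t ^ 2] for each [n], increasing to [`|t|] when
   [`|t| <= 1]. *)
Fixpoint abs_iter (R : realType) (t2 : R) (n : nat) : R :=
  if n is m.+1 then
    let s := abs_iter t2 m in 2^-1 * t2 + (- 2^-1 * (s * s) + s)
  else 0.

(** The error [r = t - s] becomes [r * (1 - (t + s) / 2)], at most [r - r ^+ 2 / 2] because
    [0 <= s]. This bound increases with [r] on [0, 1], so the induction compares it at
    [a = 2 / m]. *)
Lemma abs_iter_bound (R : realType) (t : R) (n : nat) : 0 <= t <= 1 ->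
  0 <= t - abs_iter (t * t) n <= 2 / n.+2%:R /\ 0 <= abs_iter (t * t) n.
Proof.
move=> /andP[t0 t1]; elim: n => [|n []] /=.
  by rewrite subr0 divff// t0 t1 lexx.
set s := abs_iter _ n; set m : R := n.+2%:R => /andP[s1 s2] s0.
have m2 : 2 <= m by rewrite /m ler_nat.
have -> : n.+3%:R = m + 1 :> R by rewrite /m -natr1.
set a := 2 / m in s2.
have a1 : a <= 1 by rewrite /a ler_pdivrMr ?mul1r//; lra.
have a2 : a - a ^+ 2 / 2 <= 2 / (m + 1).
  rewrite -subr_ge0 (_ : _ - _ = 2 / (m ^+ 2 * (m + 1))); last first.
    by rewrite /a; field; apply/andP; split; lra.
  by rewrite divr_ge0// mulr_ge0//; [rewrite sqr_ge0|lra].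
split; last nra.
apply/andP; split; first nra.
apply: le_trans a2; nra.
Qed.

Lemma within_near_lt (R : realType) (X : topologicalType) (K : set X)
    (f g : X -> R) (c : R) (x : X) :
  {within K, continuous f} -> {within K, continuous g} -> K x ->
  f x - g x < c ->
  exists2 U, nbhs x U & forall y, (K `&` U) y -> f y - g y < c.
Proof.
move=> /subspace_continuousP fK /subspace_continuousP gK Kx fgx.
have fgc := cvgr_lt _ (cvgB (fK x Kx) (gK x Kx)) _ fgx.
exists [set y | K y -> f y - g y < c]; first exact: fgc.
by move=> y [Ky]; exact.
Qed.

Lemma within_bounded (R : realType) (X : topologicalType) (K : set X)
    (f : X -> R) : compact K -> {within K, continuous f} ->
  exists2 M, 0 < M & forall x, K x -> `|f x| <= M.
Proof.
move=> cK cf; have := compact_bounded (continuous_compact cf cK).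
by move=> /pinfty_ex_gt0[M M0 fM]; exists M => // x Kx; apply: fM; exists x.
Qed.

Section StoneWeierstrass.
Context (R : realType) (X : topologicalType) (K : set X) (A : set (X -> R)).
Hypotheses (cK : compact K) (A_lin : linear_closed_set A)
  (A_mul : forall f g, A f -> A g -> A (f \* g)) (A_one : A (cst 1))
  (A_cont : forall f, A f -> {within K, continuous f})
  (A_sep : forall x y, K x -> K y -> x <> y -> exists2 g, A g & g x <> g y).

Let V := uniform_closure K A.
Let V_lin : linear_closed_set V := uniform_closure_linear K A_lin.

Let A_cst (b : R) : A (cst b).
Proof.
rewrite (_ : cst b = b *: cst 1 + 0); first exact: A_lin.2 A_one A_lin.1.
by apply/funext => x; rewrite fct_linE /= mulr1 addr0.
Qed.

(** It suffices to treat [g] in [A]. Dividing by a bound [M] on [K] gives [h] with values in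
    [-1, 1], and the iterates at [h ^ 2], being polynomials, stay in [A]. *)
Lemma uniform_closure_norm f : V f -> V (fun x => `|f x|).
Proof.
move=> clf; apply: uniform_closure_idem => e e0.
have [g Ag fg] := clf e e0; exists (fun x => `|g x|); last first.
  by move=> x /fg; apply: le_lt_trans; exact: ler_dist_dist.
move=> {clf f fg e e0} e e0.
have [M M0 gM] := within_bounded cK (A_cont Ag).
pose h := M^-1 *: g + 0.
have Ah : A h := A_lin.2 _ _ _ Ag A_lin.1.
pose p n x := abs_iter (h x * h x) n.
have Ap n : A (p n).
  elim: n => [|n IH]; first exact: A_lin.1.
  exact: A_lin.2 (A_mul Ah Ah) (A_lin.2 _ _ _ (A_mul IH IH) IH).
(* Chosen so that [2 * M / e < n + 1], whence the error [M * (2 / (n + 2))] is below [e]. *)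
pose n := Num.truncn (2 * M / e).
exists (M *: p n + 0); first exact: A_lin.2 _ _ _ (Ap n) A_lin.1.
move=> x Kx.
have hx : h x = M^-1 * g x by rewrite /h fct_linE addr0.
have gx : `|g x| = M * `|h x|.
  by rewrite hx normrM gtr0_norm ?invr_gt0// mulrA divff ?gt_eqF// mul1r.
have t01 : 0 <= `|h x| <= 1.
  rewrite normr_ge0 hx normrM gtr0_norm ?invr_gt0//.
  by rewrite mulrC ler_pdivrMr// mul1r gM.
have [] := abs_iter_bound n t01.
rewrite -normrM ger0_norm -?expr2 ?sqr_ge0// => /andP[r0 r1] _.
rewrite (_ : _ - _ = M * (`|h x| - abs_iter (h x ^+ 2) n)); last first.
  by rewrite fct_linE addr0 mulrBr gx expr2.
rewrite ger0_norm ?mulr_ge0// ?(ltW M0)//.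
apply: le_lt_trans (ler_wpM2l (ltW M0) r1) _.
rewrite mulrA ltr_pdivrMr// [M * 2]mulrC [e * _]mulrC -ltr_pdivrMr//.
by rewrite (lt_trans (truncnS_gt _))// ltr_nat.
Qed.

Lemma uniform_closure_max f g : V f -> V g -> V (f \max g).
Proof.
move=> Vf Vg; have Vn := uniform_closure_norm (V_lin.2 (-1) _ _ Vg Vf).
have := V_lin.2 2^-1 _ _ (V_lin.2 1 _ _ Vn (V_lin.2 1 _ _ Vf Vg)) V_lin.1.
congr V; apply/funext => x; rewrite !fct_linE /= maxr_absE.
by rewrite [-1 * g x]mulN1r [- g x + _]addrC addr0; field.
Qed.

Lemma uniform_closure_min f g : V f -> V g -> V (f \min g).
Proof.
move=> Vf Vg; have Vn := uniform_closure_norm (V_lin.2 (-1) _ _ Vg Vf).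
have := V_lin.2 2^-1 _ _ (V_lin.2 (-1) _ _ Vn (V_lin.2 1 _ _ Vf Vg)) V_lin.1.
congr V; apply/funext => x; rewrite !fct_linE /= minr_absE.
by rewrite [-1 * g x]mulN1r [- g x + _]addrC addr0; field.
Qed.

Let interpolation (f : X -> R) x y : K x -> K y ->
  exists2 g, A g & g x = f x /\ g y = f y.
Proof.
move=> Kx Ky; have [->|/eqP xy] := eqVneq x y; first by exists (cst (f y)).
have [s As /eqP sxy] := A_sep Kx Ky xy.
pose a := (f y - f x) / (s y - s x).
exists (a *: s + cst (f x - a * s x)); first exact: A_lin.2.
by rewrite !fct_linE /a /=; split; field; rewrite subr_eq0 eq_sym.
Qed.

(** Lattice argument in two stages, [compact_ind] replacing finite subcovers: maxima of two-point
    interpolants stay above [f - d] and agree with [f] at [x]; minima of such functions over varying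
    [x] come uniformly close to [f]. *)
Lemma stone_weierstrass (f : X -> R) :
  {within K, continuous f} -> uniform_closure K A f.
Proof.
move=> cf; apply: uniform_closure_idem => e e0; rewrite -/V.
have lower x d : K x -> 0 < d ->
    exists2 h, V h & h x = f x /\ forall y, K y -> f y - h y < d.
  move=> Kx d0; apply: (@compact_ind _ K (fun B => exists2 h, V h &
    h x = f x /\ forall y, B y -> f y - h y < d)) => //.
  - by exists (cst (f x)) => //; exact: uniform_closure_subset.
  - move=> B C CB [h Vh [hx hB]]; exists h => //; split=> // y /CB; exact: hB.
  - move=> B C [h Vh [hx hB]] [g Vg [gx gC]].
    exists (h \max g); first exact: uniform_closure_max.
    rewrite /= hx gx maxxx; split=> // y [/hB|/gC]; apply: le_lt_trans.
    + by rewrite lerB// le_max lexx.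
    + by rewrite lerB// le_max lexx orbT.
  - move=> y Ky; have [g Ag [gx gy]] := interpolation f Kx Ky.
    have [|U Uy fgU] := within_near_lt (c := d) cf (A_cont Ag) Ky.
      by rewrite gy subrr.
    by exists U => //; exists g => //; exact: uniform_closure_subset.
(* The lower estimate is kept on all of [K], since it survives minima; only the upper one is
   local. *)
have [h Vh [fh hf]] : exists2 h, V h &
    (forall y, K y -> f y - h y < e) /\ forall y, K y -> h y - f y < e.
  apply: (@compact_ind _ K (fun B => exists2 h, V h &
    (forall y, K y -> f y - h y < e) /\ forall y, B y -> h y - f y < e)) => //.
  - have [M M0 fM] := within_bounded cK cf.
    exists (cst M); first exact: uniform_closure_subset.
    by split=> // y /fM /ler_normlW /=; lra.
  - move=> B C CB [h Vh [fh hB]]; exists h => //; split=> // y /CB; exact: hB.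
  - move=> B C [h Vh [fh hB]] [g Vg [fg gC]].
    exists (h \min g); first exact: uniform_closure_min.
    split=> [y Ky|y [/hB|/gC]].
    + by rewrite /= minEle; case: ifP => _; [exact: fh|exact: fg].
    + by apply: le_lt_trans; rewrite lerB// ge_min lexx.
    + by apply: le_lt_trans; rewrite lerB// ge_min lexx orbT.
  (* [A_cont] concerns [A], so [h] is replaced by a nearby [g] in [A]; each of the two estimates
     costs [e / 2]. *)
  - move=> x Kx; have e2 : 0 < e / 2 by rewrite divr_gt0.
    have [h Vh [hx fh]] := lower x _ Kx e2.
    have [g Ag hg] := Vh _ e2.
    have [|U Ux gfU] := within_near_lt (c := e) (A_cont Ag) cf Kx.
      by have := hg _ Kx; rewrite hx ltr_distl; lra.
    exists U => //; exists g; first exact: uniform_closure_subset.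
    split=> // y Ky; have := hg _ Ky; have := fh _ Ky.
    by rewrite ltr_distl; lra.
exists h => // x Kx; rewrite ltr_distl; have := fh _ Kx; have := hf _ Kx; lra.
Qed.

End StoneWeierstrass.

(** * Linear spans of sets of functions *)

Inductive lin_span (R : realType) (X : Type) (S : set (X -> R)) :
    (X -> R) -> Prop :=
| lin_span0 : lin_span S 0
| lin_spanD a s g : S s -> lin_span S g -> lin_span S (a *: s + g).

Lemma lin_span_linear (R : realType) (X : Type) (S : set (X -> R)) :
  linear_closed_set (lin_span S).
Proof.
split=> [|a f g Sf Sg]; first exact: lin_span0.
elim: Sf => [|b s h Ss Sh IH]; first by rewrite scaler0 add0r.
by rewrite scalerDr scalerA -addrA; exact: lin_spanD.
Qed.

Lemma lin_span_subset (R : realType) (X : Type) (S : set (X -> R)) :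
  S `<=` lin_span S.
Proof.
move=> s Ss; rewrite -[s]scale1r -[1 *: s]addr0.
exact: lin_spanD Ss (lin_span0 S).
Qed.

Lemma lin_span_min (R : realType) (X : Type) (S A : set (X -> R)) :
  linear_closed_set A -> S `<=` A -> lin_span S `<=` A.
Proof.
by move=> [A0 Alin] SA f; elim=> // a s g /SA As _; exact: Alin.
Qed.

(** By bilinearity: with one factor fixed, the admissible other factors form a linear set, so each
    factor in turn reduces to a generator. *)
Lemma lin_span_mul (R : realType) (X : Type) (S : set (X -> R)) :
  (forall f g, S f -> S g -> S (f \* g)) ->
  forall f g, lin_span S f -> lin_span S g -> lin_span S (f \* g).
Proof.
move=> Smul f g Sf Sg; have [L0 Llin] := lin_span_linear S.
apply: (@lin_span_min _ _ S [set f | lin_span S (f \* g)]) Sf => [|s Ss].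
  split=> [|a f1 f2 Lf1 Lf2] /=.
    by rewrite (_ : _ \* _ = 0)//; apply/funext => x; exact: mul0r.
  rewrite (_ : _ \* _ = a *: (f1 \* g) + (f2 \* g)); first exact: Llin.
  by apply/funext => x; rewrite /= !fct_linE mulrDl mulrA.
apply: (@lin_span_min _ _ S [set g | lin_span S (s \* g)]) Sg => [|t St].
  split=> [|a f1 f2 Lf1 Lf2] /=.
    by rewrite (_ : _ \* _ = 0)//; apply/funext => x; exact: mulr0.
  rewrite (_ : _ \* _ = a *: (s \* f1) + (s \* f2)); first exact: Llin.
  by apply/funext => x; rewrite /= !fct_linE mulrDr mulrCA.
by apply: lin_span_subset; exact: Smul.
Qed.

(** * Density of the exponentials of kernel sections *)

Lemma lin_span_seq (R : realType) (X I : Type) (h : I -> X -> R)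
    (w : seq (R * I)) :
  lin_span (range h) (fun x => \sum_(p <- w) p.1 * h p.2 x).
Proof.
elim: w => [|p w IH].
  have := lin_span0 (range h); congr lin_span.
  by apply/funext => x; rewrite big_nil.
have hp : range h (h p.2) by exists p.2.
have := lin_spanD p.1 hp IH; congr lin_span.
by apply/funext => x; rewrite big_cons.
Qed.

Lemma lin_span_rangeP (R : realType) (X I : Type) (h : I -> X -> R) g :
  lin_span (range h) g ->
  exists (N : nat) (c : 'I_N -> R) (a : 'I_N -> I),
    g = fun x => \sum_(j < N) c j * h (a j) x.
Proof.
move=> hg; have [w ->] : exists w : seq (R * I),
    g = fun x => \sum_(p <- w) p.1 * h p.2 x.
  elim: hg => [|b _ f [i _ <-] _ [w ->]].
    by exists [::]; apply/funext => x; rewrite big_nil.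
  by exists ((b, i) :: w); apply/funext => x; rewrite big_cons.
exists (size w), (fun i => (tnth (in_tuple w) i).1),
  (fun i => (tnth (in_tuple w) i).2).
by apply/funext => x; rewrite big_tnth.
Qed.

Lemma sup_norm_le (R : realType) (X : Type) (K : set X) (g : X -> R) (e : R) :
  0 <= e -> (forall x, K x -> `|g x| <= e) -> sup_norm K g <= e.
Proof.
(* For empty [K] the supremum is 0 by convention, and [0 <= e] settles the case. *)
move=> e0 ge; have [->|/set0P[x Kx]] := eqVneq K set0.
  by rewrite /sup_norm image_set0 sup0.
apply: ge_sup; first by exists `|g x|, x.
by move=> _ [y Ky <-]; exact: ge.
Qed.

Lemma rkhs_kernel_separates (R : realType) (X : Type) (k : X -> X -> R)
    (H : set (X -> R)) ip (x y : X) :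
  is_rkhs k H ip -> separates_points H -> x <> y -> exists a, k a x <> k a y.
Proof.
move=> Hk Hsep /Hsep[psi Hpsi psixy]; apply: contrapT => kxy; apply: psixy.
rewrite (rkhs_reproducing Hk x Hpsi) (rkhs_reproducing Hk y Hpsi).
congr ip; apply/funext => a /=; apply: contrapT => kaxy.
by apply: kxy; exists a.
Qed.

Theorem theorem5p1 (R : realType) (X : topologicalType)
    (X_lc : locally_compact [set: X]) (X_T2 : hausdorff_space X)
    (k : X -> X -> R)
    (k_kernel : is_kernel k)
    (k_cont : continuous (fun p : X * X => k p.1 p.2))
    (H : set (X -> R)) (ip : (X -> R) -> (X -> R) -> R)
    (H_rkhs : is_rkhs k H ip)
    (H_sep : separates_points H)
    (K : set X) (K_compact : compact K)
    (eps : R) (eps_gt0 : 0 < eps)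
    (f : X -> R) (f_cont : {within K, continuous f}) :
  exists (N : nat) (c : 'I_N -> R) (a : 'I_N -> X),
    sup_norm K (fun x => f x - \sum_(j < N) c j * expR (k x (a j))) < eps.
Proof.
set S := lin_span (range (fun a x => expR (k x a))).
(* Continuity of [psi] is built into [E] so that its span consists of continuous functions; 0, sums
   and the sections of [k] all respect it. *)
pose E := [set g | exists2 psi, H psi /\ continuous psi & g = expR \o psi].
have HH := rkhs_hilbert H_rkhs.
have k_at_cont a : continuous (k ^~ a).
  move=> x; apply: (@continuous_comp _ _ _ (fun z => (z, a))
    (fun p : X * X => k p.1 p.2)); last exact: k_cont.
  by apply: cvg_pair => /=; [exact: cvg_id|exact: cvg_cst].
have E_cont g : lin_span E g -> continuous g.
  elim=> [x|b _ h [psi [_ psi_cont] ->] _ h_cont x].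
    exact: cvg_cst.
  apply: cvgD (h_cont x); apply: cvgZl_tmp.
  apply: (@continuous_comp _ _ _ psi expR); first exact: psi_cont.
  exact: continuous_expR.
have span_E_dense : uniform_closure K (lin_span E) f.
  apply: stone_weierstrass f_cont => //.
  - exact: lin_span_linear.
  - apply: lin_span_mul => _ _ [p [Hp p_cont] ->] [q [Hq q_cont] ->].
    exists (1 *: p + q); last first.
      by apply/funext => x; rewrite /= fct_linE mul1r expRD.
    split; first exact: (hfs_linear HH).
    by rewrite scale1r => x; exact: cvgD (p_cont x) (q_cont x).
  - apply: lin_span_subset; exists 0; last first.
      by apply/funext => x; rewrite /= expR0.
    by split; [exact: (hfs_zero HH)|move=> x; exact: cvg_cst].
  - by move=> g Eg; apply: continuous_subspaceT; exact: E_cont.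
  - move=> x y _ _ xy.
    have [a kaxy] := rkhs_kernel_separates H_rkhs H_sep xy.
    exists (fun z => expR (k z a)).
      apply: lin_span_subset; exists (k ^~ a) => //.
      by split; [exact: (rkhs_kernel H_rkhs)|exact: k_at_cont].
    by move=> /expR_inj; rewrite !(k_kernel.1 a).
have [M M0 kM] : exists2 M, 0 < M & forall x, K x -> `|k x x| <= M.
  apply: within_bounded K_compact _; apply: continuous_subspaceT => x.
  apply: (@continuous_comp _ _ _ (fun z => (z, z))
    (fun p : X * X => k p.1 p.2)); last exact: k_cont.
  by apply: cvg_pair => /=; exact: cvg_id.
(* The uniform closure of [S] is linear, so only the generators [expR \o psi] need approximating. *)
have E_S : lin_span E `<=` uniform_closure K S.
  apply: lin_span_min.
    by apply: uniform_closure_linear; exact: lin_span_linear.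
  move=> _ [psi [Hpsi _] ->] e e0.
  have [w wP] := rkhs_exp_approx M H_rkhs Hpsi e0.
  exists (fun x => \sum_(p <- w) p.1 * expR (k x p.2)).
    exact: (lin_span_seq (fun a x => expR (k x a))).
  by move=> x Kx; apply: wP; exact: le_trans (ler_norm _) (kM x Kx).
(* Strict pointwise bounds give only a weak bound on the supremum; halving [eps] restores
   strictness. *)
have eps2 : 0 < eps / 2 by rewrite divr_gt0.
have clSf := uniform_closure_idem (uniform_closure_mono E_S span_E_dense).
have [g Sg fg] := clSf _ eps2.
have [N [c [a gE]]] := lin_span_rangeP Sg.
exists N, c, a; apply: (@le_lt_trans _ _ (eps / 2)); last first.
  by rewrite ltr_pdivrMr// ltr_pMr// ltr1n.
by apply: sup_norm_le (ltW eps2) _ => x Kx; move: (fg x Kx); rewrite gE => /ltW.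
Qed.
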